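(* Given a $C^0$ non-wandering flow on a generalized Peano continuum $M$, either (1) $H\mathcal{S}=\emptyset$, i.e. the Lyapunov unstable compact minimal sets are $d_H$ dense in $\mathrm{CMin}$, or (2) $H\mathcal{S}=\{M\}$, i.e. $M$ is compact and the flow is minimal, or (3) $H\mathcal{S}$ (with the Hausdorff metric) is the union of $\beta$ disjoint non-degenerate generalized Peano continua $X_i$, $i\in\beta$, each clopen in $H\mathcal{S}$, where $1\le\beta\le\aleph_0=|\mathbb{N}|$, and each $X_i^*\subset M$ is a nonvoid connected, open invariant set.
   Context: A generalized Peano continuum is a locally compact, connected and locally connected metric space; non-degenerate means having more than one point. A $C^0$ flow on $M$ is a continuous action of $(\mathbb{R},+)$ on $M$, written $(t,x)\mapsto x^t$. It is non-wandering if every point of $M$ is non-wandering (for every neighbourhood $V$ of $x$ and every $T>0$ there is $t\ge T$ with $V^t\cap V\ne\emptyset$). A minimal set is a nonempty closed invariant set containing no smaller nonempty closed invariant set; the flow is minimal if $M$ is a minimal set. $\mathrm{CMin}$ is the set of all compact minimal sets of the flow, endowed with the Hausdorff metric $d_H$. A neighbourhood of a set $Y\subset M$ is a set whose interior contains $Y$. A nonempty compact invariant set $K$ is (Lyapunov) stable if every neighbourhood of $K$ contains a positively invariant neighbourhood of $K$; otherwise unstable. $\mathcal{U}$ is the set of unstable compact minimal sets. $\Lambda\in\mathrm{CMin}$ is hyper-stable if some neighbourhood of $\Lambda$ in $M$ intersects no $\Gamma\in\mathcal{U}$; $H\mathcal{S}$ is the set of hyper-stable compact minimal sets (equivalently $H\mathcal{S}$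 is the complement in $\mathrm{CMin}$ of the $d_H$-closure of $\mathcal{U}$). For $C\subset\mathrm{CMin}$, $C^*:=\bigcup_{\Lambda\in C}\Lambda\subset M$. *)

(* Defs.v *)
From HB Require Import structures.
From mathcomp Require Import all_boot all_order all_algebra.
From mathcomp Require Import all_classical all_reals all_analysis.
From mathcomp Require Import lra.

Set Implicit Arguments.
Unset Strict Implicit.
Unset Printing Implicit Defensive.

Import Order.TTheory GRing.Theory Num.Theory.
Import numFieldNormedType.Exports.

Local Open Scope classical_set_scope.
Local Open Scope ring_scope.

(* The library only equips [set_type A] with the restricted pseudometric. *)
Section subtype_metric.
Context {R : realType} {T : metricType R} (A : set T).

Let sdist (x y : A) : R := mdist (set_val x) (set_val y).

Let sdist_ge0 x y : 0 <= sdist x y.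
Proof. exact: mdist_ge0. Qed.

Let sdist_positivity x y : sdist x y = 0 -> x = y.
Proof. by move=> /mdist_positivity; exact: val_inj. Qed.

Let ballEsdist (x : A) (d : R) : ball x d = [set y | sdist x y < d].
Proof. by rewrite -initial_ballE ballEmdist. Qed.

HB.instance Definition _ :=
  @PseudoMetric_isMetric.Build R (set_type A) sdist sdist_ge0
    sdist_positivity ballEsdist.

Lemma set_type_mdistE (x y : A) :
  mdist x y = mdist (set_val x : T) (set_val y).
Proof. by []. Qed.

End subtype_metric.

Section hausdorff_distance.
Context {R : realType} {T : metricType R}.
Implicit Types A B C : set T.

Definition set_dist A (x : T) : R := inf [set mdist x a | a in A].

(* Only meaningful for bounded nonempty sets: [sup] and [inf] are total. *)
Definition hausdorff_dist A B : R :=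
  Num.max (sup [set set_dist B a | a in A]) (sup [set set_dist A b | b in B]).

Lemma set_dist_le A x a : A a -> set_dist A x <= mdist x a.
Proof.
move=> Aa; apply: ge_inf; last by exists a.
by exists 0 => _ [b _ <-]; exact: mdist_ge0.
Qed.

Lemma set_dist_ge0 A x : A !=set0 -> 0 <= set_dist A x.
Proof.
move=> [a Aa]; apply: lb_le_inf; first by exists (mdist x a), a.
by move=> _ [b _ <-]; exact: mdist_ge0.
Qed.

Lemma set_dist_adherent A x (e : R) : A !=set0 -> 0 < e ->
  exists2 a, A a & mdist x a < set_dist A x + e.
Proof.
move=> [a Aa] e0.
have [|_ [b Ab <-] xb] := @inf_adherent _ [set mdist x a | a in A] _ e0.
  split; first by exists (mdist x a), a.
  by exists 0 => _ [b _ <-]; exact: mdist_ge0.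
by exists b.
Qed.

Lemma mdist_continuous (x : T) : continuous (mdist x : T -> R).
Proof.
move=> y; apply/cvgrPdist_lt => e e0; near=> z.
have yz : mdist y z < e.
  near: z; have := nbhsx_ballx y e e0; rewrite ballEmdist; exact.
rewrite ltr_norml; have := metric_triangle x y z; have := metric_triangle x z y.
rewrite (metric_sym z y) => *; apply/andP; split; lra.
Unshelve. all: by end_near. Qed.

Lemma compact_mdist_bounded A (x : T) : compact A ->
  exists r : R, forall a, A a -> mdist x a <= r.
Proof.
move=> cA.
have /compact_bounded[r [_ Hr]] : compact ((mdist x : T -> R^o) @` A).
  apply: continuous_compact => //; apply: continuous_subspaceT.
  exact: mdist_continuous.
exists (r + 1) => a Aa; apply: le_trans (ler_norm _) _.
by apply: Hr; [rewrite ltrDl|exists a].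
Qed.

Lemma hausdorff_dist_leP A B (r : R) :
  compact A -> A !=set0 -> compact B -> B !=set0 ->
  hausdorff_dist A B <= r <->
  (forall a, A a -> set_dist B a <= r) /\ (forall b, B b -> set_dist A b <= r).
Proof.
have half C D : compact C -> C !=set0 -> D !=set0 ->
    sup [set set_dist D c | c in C] <= r <->
    (forall c, C c -> set_dist D c <= r).
  move=> cC [c0 Cc0] [d Dd]; split=> [supr c Cc|supr].
    apply: le_trans supr; apply: ub_le_sup; last by exists c.
    have [s Hs] := compact_mdist_bounded d cC; exists s => _ [x Cx <-].
    by apply: le_trans (set_dist_le _ Dd) _; rewrite metric_sym Hs.
  apply: ge_sup; first by exists (set_dist D c0), c0.
  by move=> _ [c Cc <-]; exact: supr.
move=> cA A0 cB B0; rewrite /hausdorff_dist ge_max; split.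
  by move=> /andP[/half hA /half hB]; split; [exact: hA|exact: hB].
by move=> [hA hB]; apply/andP; split; apply/half.
Qed.

Lemma hausdorff_distC A B : hausdorff_dist A B = hausdorff_dist B A.
Proof. by rewrite /hausdorff_dist maxC. Qed.

End hausdorff_distance.

(* The nonempty compact subsets of [T], metrized by the Hausdorff distance. *)
Record hyperspace {R : realType} (T : metricType R) := Hyperspace {
  hset :> set T ;
  hset_compact : compact hset ;
  hset_nonempty : hset !=set0 }.

Lemma hset_inj {R : realType} (T : metricType R) :
  injective (@hset R T).
Proof.
move=> [A cA A0] [B cB B0] /= AB; subst B.
by rewrite (Prop_irrelevance cA cB) (Prop_irrelevance A0 B0).
Qed.

Section hyperspace_metric.
Context {R : realType} {T : metricType R}.
Implicit Types A B C : hyperspace T.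

HB.instance Definition _ := gen_eqMixin (hyperspace T).
HB.instance Definition _ := gen_choiceMixin (hyperspace T).

Let d A B : R := hausdorff_dist A B.

Let dP A B (r : R) : d A B <= r <->
  (forall a, hset A a -> set_dist B a <= r) /\
  (forall b, hset B b -> set_dist A b <= r).
Proof.
apply: hausdorff_dist_leP;
  by [exact: hset_compact | exact: hset_nonempty].
Qed.

Let d_ge0 A B : 0 <= d A B.
Proof.
have [a Aa] := hset_nonempty A; have /dP[/(_ a Aa) + _] := lexx (d A B).
by apply: le_trans; exact: set_dist_ge0 (hset_nonempty B).
Qed.

Let dxx A : d A A = 0.
Proof.
apply/eqP; rewrite eq_le d_ge0 andbT; apply/dP.
by split=> a Aa; rewrite -(mdistxx a); exact: set_dist_le.
Qed.

Let d_positivity A B : d A B = 0 -> A = B.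
Proof.
move=> AB0; apply: hset_inj.
have sub (C D : hyperspace T) : (forall c, hset C c -> set_dist D c <= 0) -> hset C `<=` hset D.
  move=> CD c Cc.
  have cD : closed (hset D).
    by apply: compact_closed; [exact: metric_hausdorff|exact: hset_compact].
  apply: cD => V /nbhs_ballP[e /= e0]; rewrite ballEmdist => eV.
  have [b Db cb] := set_dist_adherent c (hset_nonempty D) e0.
  exists b; split=> //; apply: eV => /=.
  by apply: lt_le_trans cb _; rewrite gerDr CD.
have /dP[hA hB] : d A B <= 0 by rewrite AB0.
by apply/seteqP; split; exact: sub.
Qed.

Let d_sym A B : d A B = d B A.
Proof. exact: hausdorff_distC. Qed.

Let d_triangle B A C : d A C <= d A B + d B C.
Proof.
have half (E F G : hyperspace T) e : hset E e -> set_dist G e <= d E F + d F G.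
  move=> Ee; apply/ler_addgt0Pl => /= r r0.
  have r20 : 0 < r / 2 by rewrite divr_gt0.
  have /dP[/(_ _ Ee) EF _] := lexx (d E F).
  have [f Ff ef] := set_dist_adherent e (hset_nonempty F) r20.
  have /dP[/(_ _ Ff) FG _] := lexx (d F G).
  have [g Gg fg] := set_dist_adherent f (hset_nonempty G) r20.
  have := set_dist_le e Gg; have := metric_triangle e f g.
  by move=> *; lra.
apply/dP; split=> [a Aa|c Cc]; first exact: half.
by rewrite addrC (d_sym A B) (d_sym B C); exact: half.
Qed.

HB.instance Definition _ :=
  @isMetric.Build R (hyperspace T) d dxx d_positivity d_sym d_triangle.

Lemma hyperspace_mdistE A B : mdist A B = hausdorff_dist A B.
Proof. by []. Qed.

End hyperspace_metric.

Definition locally_connected (X : topologicalType) :=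
  forall (x : X) (U : set X), nbhs x U ->
    exists V : set X, [/\ open V, V x, connected V & V `<=` U].

Definition generalized_peano_continuum {R : realType} (X : metricType R) :=
  [/\ locally_compact [set: X], connected [set: X] & locally_connected X].

Definition non_degenerate (X : Type) := exists x y : X, x <> y.

Section flows.
Context {R : realType} {M : metricType R}.
Implicit Types (phi : R -> M -> M) (A K V Y : set M).

Definition is_flow phi :=
  [/\ continuous (fun tx : R * M => phi tx.1 tx.2),
      forall x, phi 0 x = x &
      forall s t x, phi (s + t) x = phi s (phi t x)].

Definition nonwandering phi :=
  forall (x : M) (V : set M) (T : R), nbhs x V -> 0 < T ->
    exists2 t, T <= t & (phi t @` V) `&` V !=set0.

Definition flow_invariant phi A := forall t, phi t @` A = A.

Definition positively_invariant phi A :=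
  forall t, 0 <= t -> phi t @` A `<=` A.

Definition minimal_set phi A :=
  [/\ A !=set0, closed A, flow_invariant phi A &
      forall B : set M, B !=set0 -> closed B -> flow_invariant phi B ->
        B `<=` A -> B = A].

Definition minimal_flow phi := minimal_set phi [set: M].

Definition neighbourhood Y V := Y `<=` V°.

Definition lyapunov_stable phi K :=
  forall V, neighbourhood K V ->
    exists W : set M,
      [/\ neighbourhood K W, positively_invariant phi W & W `<=` V].

Definition CMin phi : set (hyperspace M) := [set L | minimal_set phi L].

Definition unstable_min phi : set (hyperspace M) :=
  [set L | CMin phi L /\ ~ lyapunov_stable phi L].

Definition hyperstable_min phi : set (hyperspace M) :=
  [set L | CMin phi L /\
    exists2 V, neighbourhood L V &
      forall G, unstable_min phi G -> V `&` G = set0].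

Definition star (C : set (hyperspace M)) : set M := \bigcup_(L in C) hset L.

End flows.

(* Main.v *)
Require Import Defs.
From mathcomp Require Import all_boot all_order all_algebra.
From mathcomp Require Import all_classical all_reals all_analysis.
From mathcomp Require Import lra.
Import Order.TTheory GRing.Theory Num.Theory.
Import numFieldNormedType.Exports.
Local Open Scope classical_set_scope.
Local Open Scope ring_scope.

Set Implicit Arguments.
Unset Strict Implicit.
Unset Printing Implicit Defensive.

(** The orbit closures near a hyper-stable minimal set form a continuous
    foliation of an open part of M, and HS is its leaf space.

    The dynamical core is that a point x whose omega-limit set meets a stable
    compact set K lies in K ([stable_absorbs_omega]): otherwise K has a
    positively invariant neighbourhood missing a neighbourhood of x, the points
    near x enter it and never come back, and x is wandering.  Now let L be
    hyper-stable.  Being stable, it has arbitrarily small positively invariant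
    neighbourhoods W, and M is locally compact, so every x in W has a compact
    omega-limit set close to L; by Zorn it contains a minimal set G, and G is
    stable because there are no unstable minimal sets around L.  Hence x is in
    G: the points near L all lie in hyper-stable minimal sets
    ([near_hyperstable]).

    A minimal set G that has a point close to a stable minimal set L is close
    to L for the Hausdorff distance: G cannot leave the neighbourhoods of L
    because L is stable, and it comes near every point of L because the orbits
    in L are dense in L ([near_stable_mdist]).  This identifies HS with the
    complement of the closure of the unstable minimal sets in CMin.  It also
    says that the map [leaf], sending a point of HS^* to the minimal set
    through it, is continuous; it is open onto HS since a Hausdorff neighbour
    of L meets every open set that meets L.  So HS inherits local compactness
    and local connectedness from HS^*, which is open in M; its components are
    generalized Peano continua, clopen in HS.

    Let X be a component.  X^* is the preimage of X under [leaf], hence open,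
    and it is connected because X and the leaves are ([star_connected]).  If X
    were a single L, then L = X^* would be clopen in the connected space M, so
    that L = M and HS = {M}.  Finally M is separable, as a connected locally
    compact metric space, and a countable dense set meets every X^*; so there
    are at most countably many components. *)

(** * Connectedness, compactness and metric neighbourhoods *)

Section connectedness.
Context {T : topologicalType}.
Implicit Types A Y : set T.

(** Y is relatively clopen in A, in a form that lets Y be described by a
    property of points without exhibiting open and closed sets of the ambient
    space. *)
Definition locally_decided A Y :=
  (forall a, A a -> Y a -> \forall x \near a, A x -> Y x) /\
  (forall a, A a -> ~ Y a -> \forall x \near a, A x -> ~ Y x).

Lemma connected_locally_decided A Y :
  connected A -> A `&` Y !=set0 -> locally_decided A Y -> A `<=` Y.
Proof.
move=> cA AY0 [inY outY]; rewrite -setIidPl; apply: cA => //.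
- exists [set x | A x -> Y x]°; first exact: open_interior.
  apply/seteqP; split=> x [Ax]; first by move=> Yx; split=> //; exact: inY.
  by move/nbhs_singleton => /(_ Ax).
- exists (~` [set x | A x -> ~ Y x]°); first exact/open_closedC/open_interior.
  apply/seteqP; split=> x [Ax].
    by move=> Yx; split=> // /nbhs_singleton /(_ Ax).
  by move=> nYx; split=> //; apply: contrapT => /(outY _ Ax).
Qed.

Lemma locally_decided_connected A :
  (forall Y, A `&` Y !=set0 -> locally_decided A Y -> A `<=` Y) -> connected A.
Proof.
move=> dA B [b Bb] [C oC BC] [D cD BD].
have BA : B `<=` A by rewrite BC; exact: subIsetl.
apply/seteqP; split=> //; apply: dA; first by exists b; split=> //; exact: BA.
split=> a Aa Ba.
  have Ca : nbhs a C.
    by apply: open_nbhs_nbhs; split=> //; move: Ba; rewrite BC => -[].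
  by apply: filterS Ca => x Cx Ax; rewrite BC.
have Da : nbhs a (~` D).
  apply: open_nbhs_nbhs; split; first exact: closed_openC.
  by move=> Da; apply: Ba; rewrite BD.
by apply: filterS Da => x nDx Ax; rewrite BD => -[].
Qed.

End connectedness.

Section compactness.
Context {T : topologicalType}.
Implicit Types A K : set T.

(** Near-covering along the chain itself: each point of K has a neighbourhood
    contained in all sufficiently large members of the chain. *)
Lemma compact_chain_cover K (F : set (set T)) :
  compact K -> F !=set0 -> total_on F subset -> (forall A, F A -> open A) ->
  K `<=` \bigcup_(A in F) A -> exists2 A, F A & K `<=` A.
Proof.
move=> /compact_near_coveringP cK F0 totF oF KF.
pose G : set_system (set T) :=
  filter_from F (fun A => [set B | F B /\ A `<=` B]).
have GG : Filter G.
  apply: filter_from_filter => // A B FA FB; have [AB|BA] := totF _ _ FA FB.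
    by exists B => // C [FC BC]; split; split=> //; exact: subset_trans AB BC.
  by exists A => // C [FC sAC]; split; split=> //; exact: subset_trans BA sAC.
suff [A FA KA] : G [set B | K `<=` B] by exists A => //; apply: KA; split.
  apply: (cK _ G (fun B x => B x)) => x /KF[A FA Ax].
  exists (A, [set B | F B /\ A `<=` B]) => /=.
    split; last by exists A.
    by apply: open_nbhs_nbhs; split=> //; exact: oF.
  by move=> [y B] /= [Ay [_]]; exact.
Qed.

Lemma compact_sub_compact_interior K : locally_compact [set: T] -> compact K ->
  exists2 C, compact C & K `<=` C°.
Proof.
move=> lc /compact_near_coveringP cK.
pose G : set_system (set T) :=
  filter_from (@compact T) (fun A => [set B | A `<=` B]).
have GG : Filter G.
  apply: filter_from_filter; first by exists set0; exact: compact0.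
  move=> A B cA cB; exists (A `|` B); first exact: compactU.
  by move=> C; rewrite /= subUset.
suff [C cC KC] : G [set C | K `<=` C°] by exists C => //; exact: KC.
apply: (cK _ G (fun C x => C° x)) => x Kx.
have [U Ux [cU _]] := lc x Logic.I.
have {}Ux : nbhs x U.
  have : nbhs x [set y | [set: T] y -> U y] by exact: Ux.
  by apply: filterS => y; exact.
exists (U°, [set B | U `<=` B]) => /=.
  by split; [apply: open_nbhs_nbhs; split=> //; exact: open_interior|exists U].
by move=> [y B] /= [Uy UB]; exact: (interiorS UB).
Qed.

End compactness.

Section metric_neighbourhoods.
Context {R : realType} {T : metricType R}.
Implicit Types (x y : T) (A K V : set T) (e : R).

Lemma near_mdist x e : 0 < e -> \forall y \near x, mdist x y < e.
Proof.
by move=> e0; have := nbhsx_ballx x e e0; rewrite ballEmdist.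
Qed.

Lemma nbhs_mdist x V : nbhs x V ->
  exists2 e, 0 < e & forall y, mdist x y < e -> V y.
Proof.
by move=> /nbhs_ballP[e /= e0]; rewrite ballEmdist => eV; exists e.
Qed.

Lemma closure_mdist A x e : closure A x -> 0 < e ->
  exists2 a, A a & mdist x a < e.
Proof. by move=> cAx /(near_mdist x)/cAx[a [Aa xa]]; exists a. Qed.

Lemma mdist_closure A x : (forall e, 0 < e -> exists2 a, A a & mdist x a < e) ->
  closure A x.
Proof.
move=> H V /nbhs_mdist[e e0 eV]; have [a Aa xa] := H e e0.
by exists a; split=> //; exact: eV.
Qed.

Lemma mdist_lt_split x y z e : mdist x y < e / 2 -> mdist y z < e / 2 ->
  mdist x z < e.
Proof. by move=> xy yz; have := metric_triangle x y z; lra. Qed.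

Definition thickening e K : set T := [set y | exists2 x, K x & mdist x y < e].

Lemma neighbourhood_thickening e K : 0 < e -> neighbourhood K (thickening e K).
Proof. by move=> e0 x Kx; apply: filterS (near_mdist x e0) => y; exists x. Qed.

Lemma closure_thickening e K : 0 < e ->
  closure (thickening (e / 2) K) `<=` thickening e K.
Proof.
move=> e0 y /closure_mdist/(_ (divr_gt0 e0 (ltr0Sn _ 1)))[z [x Kx xz] yz].
by exists x => //; apply: mdist_lt_split xz _; rewrite metric_sym.
Qed.

Lemma thickening_sub K V : compact K -> neighbourhood K V ->
  exists2 e, 0 < e & thickening e K `<=` V.
Proof.
move=> /compact_near_coveringP cK KV.
have H : \forall e \near (0 : R)^'+, forall x, K x ->
    forall y, mdist x y < e -> V y.
  apply: (cK _ _ (fun e x => forall y, mdist x y < e -> V y)) => x Kx.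
  have [e e0 eV] := nbhs_mdist (KV _ Kx).
  exists ([set y | mdist x y < e / 2], [set d | d < e / 2]) => /=.
    split; first by apply: near_mdist; rewrite divr_gt0.
    by apply: nbhs_right_lt; rewrite divr_gt0.
  move=> [y d] /= [xy de] z yz; apply: eV; apply: mdist_lt_split xy _.
  exact: lt_trans de.
have [e [e0 eV]] := filter_ex (filterI (nbhs_right_gt (0 : R)) H).
by exists e => // y [x Kx]; exact: eV.
Qed.

(** Near-covering along the finite sequences, ordered by inclusion: near x,
    every sequence that contains x works. *)
Lemma compact_finite_net K e : compact K -> 0 < e ->
  exists s : seq T, forall x, K x -> exists2 a, a \in s & mdist a x < e.
Proof.
move=> /compact_near_coveringP cK e0.
pose G : set_system (seq T) :=
  filter_from setT (fun s : seq T => [set s' : seq T | {subset s <= s'}]).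
have GG : Filter G.
  apply: filter_from_filter; first by exists [::].
  move=> s t _ _; exists (s ++ t) => // u stu; split=> a ast; apply: stu;
  by rewrite mem_cat ast ?orbT.
pose covers (s : seq T) x := exists2 a, a \in s & mdist a x < e.
suff [s _ sK] : G [set s | K `<=` covers s] by exists s; exact: (sK s).
  apply: (cK _ G covers) => x Kx.
  exists ([set y | mdist x y < e], [set s | {subset [:: x] <= s}]) => /=.
    by split; [exact: near_mdist|exists [:: x]].
  by move=> [y s] /= [xy xs]; exists x => //; apply: xs; rewrite inE.
Qed.

End metric_neighbourhoods.

(** * Subspaces and separability *)

Section subspaces.
Context {T : topologicalType} (A : set T).
Implicit Types (C : set T) (x : set_type A).

Lemma nbhs_set_type x (U : set (set_type A)) : nbhs x U ->
  exists2 V, nbhs (set_val x) V & set_val @^-1` V `<=` U.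
Proof.
move=> [_ /= [[W oW <-] Wx sWU]].
by exists W => //; apply: open_nbhs_nbhs.
Qed.

Lemma set_val_nbhs x (V : set T) :
  nbhs (set_val x) V -> nbhs x (set_val @^-1` V).
Proof. exact: initial_continuous. Qed.

Lemma connected_set_type C : C `<=` A -> connected C ->
  connected (set_val @^-1` C : set (set_type A)).
Proof.
move=> CA cC; apply: locally_decided_connected => Y [y [Cy Yy]] [inY outY].
have decY : C `<=` set_val @` Y.
  apply: connected_locally_decided cC _ _.
    by exists (set_val y); split=> //; exists y.
  split=> a Ca.
    move=> [a' Ya' a'a]; subst a.
    have [V Va' VY] := nbhs_set_type (inY _ Ca Ya').
    apply: filterS Va' => x Vx Cx; exists (SigSub (mem_set (CA _ Cx))) => //.
    exact: VY.
  pose a' : set_type A := SigSub (mem_set (CA _ Ca)) => nYa.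
  have nYa' : ~ Y a' by move=> Ya'; apply: nYa; exists a'.
  have [V Va' VY] := nbhs_set_type (outY a' Ca nYa').
  apply: filterS Va' => x Vx Cx [x' Yx' x'x]; subst x.
  exact: (VY x').
by move=> x /decY[x' Yx' /val_inj <-].
Qed.

Lemma compact_set_type C : C `<=` A -> compact C ->
  compact (set_val @^-1` C : set (set_type A)).
Proof.
move=> CA cC F PF FC.
have [|c [Cc cFc]] := cC (set_val @ F) _; first exact: FC.
exists (SigSub (mem_set (CA _ Cc))); split=> // B U FB /nbhs_set_type[V Vc VU].
have FB' : F (set_val @^-1` (set_val @` B)).
  by apply: filterS FB; exact: preimage_image.
have [z [[x Bx <-] Vx]] := cFc (set_val @` B) V FB' Vc.
by exists x; split=> //; exact: VU.
Qed.

End subspaces.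

Section separability.
Context {R : realType} {M : metricType R}.

(** Starting from [x0], repeatedly jump to a point of a finite net of a small
    ball whose closure is compact.  The countably many points [pt c] reached in
    this way, indexed by the finite lists c of choices, are dense: the closure
    of their set is open, because a point a of the closure lies in a small ball
    around some [pt c] whose nets also approximate all the points near a. *)
Lemma connected_locally_compact_separable (x0 : M) :
  locally_compact [set: M] -> connected [set: M] ->
  exists f : nat -> M, closure (range f) = setT.
Proof.
move=> lc cM.
pose small (d : M) (k : nat) :=
  exists2 C, compact C & forall z, mdist d z < k.+1%:R^-1 -> C z.
have /choice[net netP] (c : M * nat * nat) : exists s : seq M,
    small c.1.1 c.1.2 -> forall z, mdist c.1.1 z < c.1.2.+1%:R^-1 ->
    exists2 a, a \in s & mdist a z < c.2.+1%:R^-1.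
  case: c => [[d k] n] /=.
  have [[C cC dC]|nsmall] := pselect (small d k); last by exists [::].
  have n0 : 0 < n.+1%:R^-1 :> R by rewrite invr_gt0.
  have [s sC] := compact_finite_net cC n0.
  by exists s => _ z /dC; exact: sC.
(* A choice (k, n, i) means: in the ball of radius 1/(k+1), take the i-th
   point of its net of mesh 1/(n+1). *)
pose step (d : M) (c : nat * nat * nat) := nth d (net (d, c.1.1, c.1.2)) c.2.
pose pt (c : seq (nat * nat * nat)) := foldl step x0 c.
suff ptT : closure (range pt) = setT.
  exists (fun n => if unpickle n is Some c then pt c else x0).
  rewrite -subTset -ptT; apply: closureS => _ [c _ <-].
  by exists (pickle c) => //; rewrite pickleK.
rewrite -subTset; apply: connected_locally_decided cM _ _.
  by exists x0; split=> //; apply: subset_closure; exists [::].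
split=> a _ Ya; last first.
  suff : nbhs a (~` closure (range pt)).
    by apply: filterS => x nYx _; exact: nYx.
  apply: open_nbhs_nbhs; split=> //; exact/closed_openC/closed_closure.
have [U Ua [cU _]] := lc a Logic.I.
have {Ua} [e e0 eU] : exists2 e, 0 < e & forall y, mdist a y < e -> U y.
  apply: nbhs_mdist; have : nbhs a [set y | [set: M] y -> U y] by exact: Ua.
  by apply: filterS => y; exact.
have e20 : 0 < e / 2 by rewrite divr_gt0.
have [k ke] := filter_ex (near_infty_natSinv_lt (PosNum e20)).
set r := k.+1%:R^-1 in ke; rewrite /= in ke.
have r0 : 0 < r by rewrite invr_gt0.
have r20 : 0 < r / 2 by rewrite divr_gt0.
have [_ [c _ <-] ac] := closure_mdist Ya r20.
have smallc : small (pt c) k.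
  exists U => // z cz; apply: eU; have := metric_triangle a (pt c) z.
  by rewrite -/r in cz; lra.
apply: filterS (near_mdist a r20) => x ax _; apply: mdist_closure => d d0.
have cx : mdist (pt c) x < r.
  by apply: (@mdist_lt_split _ _ _ a); rewrite // metric_sym.
have [n nd] := filter_ex (near_infty_natSinv_lt (PosNum d0)).
have [b bnet bx] := netP (pt c, k, n) smallc x cx.
exists b; last by rewrite metric_sym; apply: lt_trans nd.
exists (rcons c (k, n, index b (net (pt c, k, n)))) => //.
by rewrite /pt foldl_rcons /step /= nth_index.
Qed.

End separability.

(** * The Hausdorff metric *)

Section hausdorff_metric.
Context {R : realType} {M : metricType R}.
Implicit Types L G : hyperspace M.

Lemma hyperspace_mdist_le L G e :
  hset L `<=` thickening e G -> hset G `<=` thickening e L -> mdist L G <= e.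
Proof.
move=> LG GL; rewrite hyperspace_mdistE; apply/hausdorff_dist_leP;
  try exact: hset_compact; try exact: hset_nonempty.
split=> [a /LG|a /GL] [b bG ba]; apply: le_trans (set_dist_le _ bG) _;
by rewrite metric_sym ltW.
Qed.

Lemma hyperspace_mdist_lt L G e : mdist L G < e -> hset L `<=` thickening e G.
Proof.
move=> LGe a La; have /hausdorff_dist_leP[] := lexx (mdist L G);
  try exact: hset_compact; try exact: hset_nonempty.
move=> /(_ a La) aG _.
have [|b Gb ab] := @set_dist_adherent _ _ _ a (e - mdist L G) (hset_nonempty G).
  by rewrite subr_gt0.
by exists b => //; rewrite metric_sym; lra.
Qed.

Lemma near_hyperspace_meets L (V : set M) x : hset L x -> nbhs x V ->
  \forall G \near L, hset G `&` V !=set0.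
Proof.
move=> Lx /nbhs_mdist[e e0 eV]; apply: filterS (near_mdist L e0) => G.
move=> /hyperspace_mdist_lt/(_ x Lx)[y Gy yx].
by exists y; split=> //; apply: eV; rewrite metric_sym.
Qed.

End hausdorff_metric.

(** * Omega-limit sets and minimal sets of a flow *)

Section dynamics.
Context {R : realType} {M : metricType R} (phi : R -> M -> M).
Context (hphi : is_flow phi).
Implicit Types (A K L V W : set M) (x y : M) (s t : R).

Lemma flow_continuous t : continuous (phi t).
Proof.
have [cphi _ _] := hphi => x.
exact: (cvg_comp _ _ (cvg_pair (cvg_cst t) cvg_id) (cphi (t, x))).
Qed.

Lemma orbit_continuous x : continuous (phi^~ x).
Proof.
have [cphi _ _] := hphi => t.
exact: (cvg_comp _ _ (cvg_pair cvg_id (cvg_cst x)) (cphi (t, x))).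
Qed.

Lemma flowD s t x : phi (s + t) x = phi s (phi t x).
Proof. by have [_ _] := hphi. Qed.

Lemma flow0 x : phi 0 x = x.
Proof. by have [_] := hphi. Qed.

Lemma flowNK t x : phi t (phi (- t) x) = x.
Proof. by rewrite -flowD subrr flow0. Qed.

Lemma flow_invariantP A :
  flow_invariant phi A <-> (forall t x, A x -> A (phi t x)).
Proof.
split=> [iA t x Ax|iA t]; first by rewrite -(iA t); exists x.
apply/seteqP; split=> [_ [x Ax <-]|x Ax]; first exact: iA.
by exists (phi (- t) x); [exact: iA|exact: flowNK].
Qed.

Definition omega x : set M := cluster (phi^~ x @ +oo).

Lemma omega_closed x : closed (omega x).
Proof.
rewrite /omega clusterE; apply: closed_bigI => A _; exact: closed_closure.
Qed.

Lemma omega_adherent x y V T : omega x y -> nbhs y V ->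
  exists2 t, T <= t & V (phi t x).
Proof.
move=> xy yV; have FA : (phi^~ x @ +oo) [set phi t x | t in [set t | T <= t]].
  by exists T; split; [exact: num_real|move=> t /ltW Tt; exists t].
by have [_ [[t Tt <-] Vt]] := xy _ _ FA yV; exists t.
Qed.

Lemma near_forward_orbit x A : (forall t, 0 <= t -> A (phi t x)) ->
  (phi^~ x @ +oo) A.
Proof. by move=> xA; exists 0; split; [exact: num_real|move=> t /ltW /xA]. Qed.

Lemma omega_sub x A : (forall t, 0 <= t -> A (phi t x)) ->
  omega x `<=` closure A.
Proof.
by move=> /near_forward_orbit xA y; rewrite /omega clusterE; apply.
Qed.

Lemma omega_nonempty x K : compact K -> (forall t, 0 <= t -> K (phi t x)) ->
  omega x !=set0.
Proof.
by move=> cK /near_forward_orbit/cK[y [Ky xy]]; exists y.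
Qed.

Lemma omega_invariant x : flow_invariant phi (omega x).
Proof.
apply/flow_invariantP => s y xy A B FA nB.
have FA' : (phi^~ x @ +oo) (phi s @^-1` A).
  have [N [Nr NA]] := FA; exists (N - s); split; first exact: num_real.
  by move=> t Nt /=; rewrite -flowD; apply: NA; rewrite -ltrBlDl.
have [z [Az Bz]] := xy _ _ FA' (flow_continuous nB).
by exists (phi s z).
Qed.

Lemma minimal_omega L x : minimal_set phi L -> compact L -> L x -> omega x = L.
Proof.
move=> [_ Lc /flow_invariantP Li Lm] cL Lx; apply: Lm.
- by apply: (omega_nonempty cL) => t _; exact: Li.
- exact: omega_closed.
- exact: omega_invariant.
- rewrite [X in _ `<=` X](iffLR (closure_id L) Lc).
  by apply: omega_sub => t _; exact: Li.
Qed.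

Lemma minimal_set_meet_eq K L x :
  minimal_set phi K -> minimal_set phi L -> K x -> L x -> K = L.
Proof.
move=> [_ Kc Ki Km] [_ Lc Li Lm] Kx Lx.
have KL0 : (K `&` L) !=set0 by exists x.
have KLc : closed (K `&` L) by exact: closedI.
have KLi : flow_invariant phi (K `&` L).
  apply/flow_invariantP => t y [Ky Ly]; move/flow_invariantP in Ki.
  by move/flow_invariantP in Li; split; [exact: Ki|exact: Li].
rewrite -(Km _ KL0 KLc KLi (@subIsetl _ _ _)); apply: Lm => //.
Qed.

(** A compact minimal set is the closure of any of its orbits, a continuous
    image of the line. *)
Lemma minimal_connected L : minimal_set phi L -> compact L -> connected L.
Proof.
move=> Lmin cL; have [[x Lx] Lc /flow_invariantP Li _] := Lmin.
have -> : L = closure (range (phi^~ x)).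
  apply/seteqP; split.
    rewrite -(minimal_omega Lmin cL Lx); apply: omega_sub => t _.
    by exists t.
  rewrite [X in _ `<=` X](iffLR (closure_id L) Lc); apply: closureS.
  by move=> _ [t _ <-]; exact: Li.
apply/connected_closure/connected_continuous_connected.
  by apply/connected_intervalP.
by apply: continuous_subspaceT; exact: orbit_continuous.
Qed.

(** A maximal open invariant set A that does not cover K leaves a minimal set
    K \ A.  Compactness of K shows that unions of chains of such A do not
    cover K either. *)
Lemma exists_minimal_set K : compact K -> K !=set0 -> flow_invariant phi K ->
  exists2 L, minimal_set phi L & L `<=` K.
Proof.
move=> cK K0 /flow_invariantP Ki.
pose P A := [/\ open A, (forall t x, A x -> A (phi t x)) & ~ K `<=` A].
have [F FP totF|A [[oA Ai KA] Amax]] := @Zorn_bigcup _ P.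
  split.
  - by apply: bigcup_open => A /FP[].
  - move=> t x [A FA Ax]; exists A => //; have [_ Ai _] := FP _ FA.
    exact: Ai.
  - move=> KF; have F0 : F !=set0 by have [x /KF[A FA _]] := K0; exists A.
    have [|A /FP[_ _]] := compact_chain_cover cK F0 totF _ KF; last exact.
    by move=> A /FP[].
have Kc : closed K by apply: compact_closed => //; exact: metric_hausdorff.
exists (K `\` A); last exact: subDsetl.
split.
- by apply/set0P/eqP; rewrite setD_eq0.
- by apply: closedI => //; exact: open_closedC.
- apply/flow_invariantP => t x [Kx nAx]; split; first exact: Ki.
  by move=> /(Ai (- t)); rewrite -flowD addNr flow0.
move=> B [b Bb] Bc /flow_invariantP Bi BKA; apply: contrapT => BneKA.
have Bd x : B x -> ~ A x by move=> /BKA[].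
apply: (Amax (~` B)).
  split=> [x Ax Bx|CBA]; first exact: Bd Bx Ax.
  apply: BneKA; apply/seteqP; split=> // x [Kx nAx].
  by apply: contrapT => /CBA.
split; first exact: closed_openC.
  move=> t x nBx Btx; apply: nBx.
  by rewrite -(flow0 x) -(addNr t) flowD; exact: Bi.
by have [Kb _] := BKA _ Bb => /(_ b Kb).
Qed.

(** The orbit of [x0] comes near every point of L; by compactness of L finitely
    many times t suffice, and for these times the orbits of [x0] and of a
    nearby point x stay close. *)
Lemma near_minimal_approx L x0 e : minimal_set phi L -> compact L -> L x0 ->
  0 < e -> \forall x \near x0, forall y, L y -> exists t, mdist (phi t x) y < e.
Proof.
move=> Lm cL Lx0 e0; have /compact_near_coveringP cL' := cL.
apply: (cL' _ _ (fun x y => exists t, mdist (phi t x) y < e)) => y Ly.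
have e30 : 0 < e / 3 by rewrite divr_gt0.
have xy : omega x0 y by rewrite (minimal_omega Lm cL Lx0).
have [t _ yt] := omega_adherent 0 xy (near_mdist y e30).
exists ([set y' | mdist y y' < e / 3],
        phi t @^-1` [set z | mdist (phi t x0) z < e / 3]) => /=.
  by split; [|apply: flow_continuous]; exact: near_mdist.
move=> [y' x] /= [yy' xx']; exists t.
have := metric_triangle (phi t x) (phi t x0) y'.
have := metric_triangle (phi t x0) y y'.
rewrite (metric_sym (phi t x) (phi t x0)) (metric_sym (phi t x0) y) /= in yt *.
lra.
Qed.

(** A compact minimal set G through a point x of a positively invariant W is
    contained in the closure of W, being the omega-limit set of x. *)
Lemma near_stable_sub_thickening L x0 e : lyapunov_stable phi L -> L x0 ->
  0 < e -> \forall x \near x0, forall G, minimal_set phi G -> compact G ->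
  G x -> G `<=` thickening e L.
Proof.
move=> Ls Lx0 e0; have e20 : 0 < e / 2 by rewrite divr_gt0.
have [W [LW Wi WV]] := Ls _ (neighbourhood_thickening (K := L) e20).
apply: filterS (LW _ Lx0) => x Wx G Gm cG Gx.
rewrite -(minimal_omega Gm cG Gx).
apply: subset_trans (closure_thickening (K := L) e0).
apply: subset_trans (closureS WV); apply: omega_sub => t t0.
by apply: (Wi t t0); exists x.
Qed.

(** The continuity, at a stable L, of the minimal set as a function of a point
    on it. *)
Lemma near_stable_mdist (L : hyperspace M) x0 e : CMin phi L ->
  lyapunov_stable phi L -> hset L x0 -> 0 < e ->
  \forall x \near x0, forall G, CMin phi G -> hset G x -> mdist L G < e.
Proof.
move=> Lm Ls Lx0 e0; have e20 : 0 < e / 2 by rewrite divr_gt0.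
have := near_minimal_approx Lm (@hset_compact _ _ L) Lx0 e20.
apply: filterS2 (near_stable_sub_thickening Ls Lx0 e20) => x LG GL G Gm Gx.
apply: (@le_lt_trans _ _ (e / 2)); last lra.
apply: hyperspace_mdist_le; last by apply: LG => //; exact: hset_compact.
move=> y /GL[t ty]; exists (phi t x) => //.
by have [_ _ /flow_invariantP Gi _] := Gm; exact: Gi.
Qed.

Context (hnw : nonwandering phi).

(** If x were not in K, a positively invariant W around K would miss a
    neighbourhood of x.  The orbit of x enters W, so the points near x enter W
    at the same time T and remain there: x would be wandering. *)
Lemma stable_absorbs_omega K x y :
  compact K -> lyapunov_stable phi K -> omega x y -> K y -> K x.
Proof.
move=> cK Ks xy Ky; apply: contrapT => nKx.
have Kc : closed K by apply: compact_closed => //; exact: metric_hausdorff.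
have [e e0 eK] : exists2 e, 0 < e & forall z, mdist x z < e -> ~ K z.
  by apply: nbhs_mdist; apply: open_nbhs_nbhs; split=> //; exact: closed_openC.
have e20 : 0 < e / 2 by rewrite divr_gt0.
have [W [KW Wi WV]] := Ks _ (neighbourhood_thickening (K := K) e20).
have yW : nbhs y W°.
  by apply: open_nbhs_nbhs; split; [exact: open_interior|exact: KW].
have [T T1 WT] := omega_adherent 1 xy yW.
have xV : nbhs x ([set z | mdist x z < e / 2] `&` phi T @^-1` W).
  by apply: filterI; [exact: near_mdist|exact: flow_continuous].
have T0 : 0 < T by exact: lt_le_trans T1.
have [t Tt [_ [[z [_ Wz] <-] [xz _]]]] := hnw xV T0.
have /WV [k Kk kz] : W (phi t z).
  rewrite -(subrK T t) flowD; apply: (Wi (t - T)); last by exists (phi T z).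
  by rewrite subr_ge0.
by apply: eK Kk; apply: mdist_lt_split xz _; rewrite metric_sym.
Qed.

End dynamics.

(** * Hyper-stable minimal sets *)

Section hyperstability.
Context {R : realType} {M : metricType R} (phi : R -> M -> M).
Context (hphi : is_flow phi) (hnw : nonwandering phi).
Context (lcM : locally_compact [set: M]).
Implicit Types (L G : hyperspace M) (C U : set (hyperspace M)) (x y : M).

Local Notation HS := (hyperstable_min phi).

Lemma CMin_meet_eq L G x :
  CMin phi L -> CMin phi G -> hset L x -> hset G x -> L = G.
Proof.
by move=> Lm Gm Lx Gx; apply: hset_inj; exact: minimal_set_meet_eq Lm Gm Lx Gx.
Qed.

Lemma star_invariant C : C `<=` CMin phi -> flow_invariant phi (star C).
Proof.
move=> CM; apply/flow_invariantP => // t x [L CL Lx]; exists L => //.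
by have [_ _ /(flow_invariantP hphi) Li _] := CM _ CL; exact: Li.
Qed.

(** A relatively clopen part Y of C^* is a union of members of C, since these
    are connected; and Hausdorff neighbours of G meet every open set that
    meets G, so the members of C inside Y form a relatively clopen part
    of C. *)
Lemma star_connected C : C `<=` CMin phi -> connected C -> connected (star C).
Proof.
move=> CM cC; apply: locally_decided_connected.
move=> Y [y [[L CL Ly] Yy]] [inY outY].
have dich G x : C G -> hset G x -> Y x -> hset G `<=` Y.
  move=> CG Gx Yx; apply: connected_locally_decided.
  - apply: (minimal_connected hphi); first exact: CM.
    exact: hset_compact.
  - by exists x.
  - split=> a Ga Ya.
      have Ca : star C a by exists G.
      by apply: filterS (inY a Ca Ya) => z + Gz; apply; exists G.
    have Ca : star C a by exists G.
    by apply: filterS (outY a Ca Ya) => z + Gz; apply; exists G.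
suff CY : C `<=` [set G | hset G `<=` Y] by move=> x [G /CY GY /GY].
apply: connected_locally_decided cC _ _.
  by exists L; split=> //; exact: dich Ly Yy.
split=> G CG GY.
  have [x Gx] := hset_nonempty G.
  have Cx : star C x by exists G.
  apply: filterS (near_hyperspace_meets Gx (inY x Cx (GY _ Gx))).
  move=> G' [z [G'z Yz]] CG'; apply: (dich _ _ CG' G'z); apply: Yz.
  by exists G'.
have [x Gx] := hset_nonempty G.
have Cx : star C x by exists G.
have nYx : ~ Y x by move=> Yx; apply: GY; exact: dich Gx Yx.
apply: filterS (near_hyperspace_meets Gx (outY x Cx nYx)).
move=> G' [z [G'z Yz]] CG' G'Y; apply: Yz; last exact: G'Y.
by exists G'.
Qed.

Lemma hyperstable_CMin L : HS L -> CMin phi L.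
Proof. by case. Qed.

Lemma hyperstable_stable L : HS L -> lyapunov_stable phi L.
Proof.
move=> [Lm [V LV VU]]; apply: contrapT => nLs.
have [x Lx] := hset_nonempty L.
have : (V `&` L) x by split=> //; exact: nbhs_singleton (LV _ Lx).
by rewrite VU.
Qed.

(** If L is stable, then an unstable minimal set that meets a small
    neighbourhood of L is also close to L for the Hausdorff distance. *)
Lemma hyperstable_closure_unstable L : CMin phi L ->
  HS L <-> ~ closure (unstable_min phi) L.
Proof.
move=> Lm; have [x Lx] := hset_nonempty L; split.
  move=> [_ [V LV VU]] /(_ _ (near_hyperspace_meets Lx (LV _ Lx))).
  by move=> [G [GU [y [Gy Vy]]]]; have : (V `&` G) y by []; rewrite VU.
move=> ncl; have Ls : lyapunov_stable phi L.
  by apply: contrapT => nLs; apply: ncl; exact: subset_closure.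
apply: contrapT => nHS; apply: ncl; apply: mdist_closure => e e0.
apply: contrapT => far; apply: nHS; split=> //.
exists [set z | forall G, CMin phi G -> hset G z -> mdist L G < e].
  by move=> z Lz; exact: near_stable_mdist.
move=> G GU; rewrite -subset0 => z [zG Gz]; apply: far; exists G => //.
by apply: zG => //; case: GU.
Qed.

(** The omega-limit set of a point y near L is compact and close to L, so it
    contains a minimal set G near L.  Hyper-stability of L makes G stable, and
    G then absorbs y. *)
Lemma near_hyperstable L x : HS L -> hset L x ->
  \forall y \near x, exists2 G, HS G & hset G y.
Proof.
move=> LHS Lx; have [Lm [V LV VU]] := LHS.
have [C cC LC] := compact_sub_compact_interior lcM (@hset_compact _ _ L).
have LVC : neighbourhood L (V° `&` C).
  move=> z Lz; apply: filterI; last exact: LC.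
  by apply: open_nbhs_nbhs; split; [exact: open_interior|exact: LV].
have [e e0 eVC] := thickening_sub (@hset_compact _ _ L) LVC.
have e20 : 0 < e / 2 by rewrite divr_gt0.
have [W [LW Wi WL]] :=
  hyperstable_stable LHS (neighbourhood_thickening (K := L) e20).
have clW : closure W `<=` V° `&` C.
  apply: subset_trans eVC; apply: subset_trans (closure_thickening (K := L) e0).
  exact: closureS.
have cW : compact (closure W).
  apply: (subclosed_compact _ cC); first exact: closed_closure.
  by move=> z /clW[].
apply: filterS (LW _ Lx) => y Wy.
have orbW t : 0 <= t -> W (phi t y) by move=> t0; apply: (Wi t t0); exists y.
have oW : omega phi y `<=` closure W := omega_sub orbW.
have co : compact (omega phi y).
  by apply: (subclosed_compact _ cW) => //; exact: omega_closed.
have o0 : omega phi y !=set0.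
  by apply: (omega_nonempty cW) => t /orbW; exact: subset_closure.
have [G Gm Go] := exists_minimal_set hphi co o0 (omega_invariant hphi y).
have [[z Gz] Gc _ _] := Gm.
pose G' := Hyperspace (subclosed_compact Gc co Go) (ex_intro _ z Gz).
have GV : neighbourhood G V by move=> w /Go/oW/clW[].
have Gs : lyapunov_stable phi G.
  apply: contrapT => nGs; have : (V `&` G') z.
    by split=> //; exact: nbhs_singleton (GV _ Gz).
  by rewrite VU.
exists G'; first by split=> //; exists V.
have cG : compact G := @hset_compact _ _ G'.
exact: (stable_absorbs_omega hphi hnw cG Gs (Go _ Gz) Gz).
Qed.

(** The leaf through x of the partition of HS^* into minimal sets.  A point
    outside HS^* is sent to its own singleton, which serves as a default. *)
Definition leaf x : hyperspace M :=
  xget (Hyperspace (@compact_set1 _ x) (ex_intro _ x erefl))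
       [set L | HS L /\ hset L x].

Lemma leaf_eq L x : HS L -> hset L x -> leaf x = L.
Proof.
move=> LHS Lx; rewrite /leaf; case: xgetP => [G _ [GHS Gx]|/(_ L)[]//].
by apply: (CMin_meet_eq (x := x)) => //; exact: hyperstable_CMin.
Qed.

Lemma near_leaf L x : HS L -> hset L x ->
  \forall y \near x, HS (leaf y) /\ hset (leaf y) y.
Proof.
move=> LHS Lx; apply: filterS (near_hyperstable LHS Lx) => y [G GHS Gy].
by rewrite (leaf_eq GHS Gy).
Qed.

Lemma leaf_continuous x : star HS x -> leaf y @[y --> x] --> leaf x.
Proof.
move=> [L LHS Lx]; have lx := leaf_eq LHS Lx.
rewrite lx => U /nbhs_mdist[e e0 eU].
have := near_stable_mdist hphi (hyperstable_CMin LHS) (hyperstable_stable LHS)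
  Lx e0.
apply: filterS2 (near_leaf LHS Lx) => y [yHS yl] Ly; apply: eU.
by apply: Ly => //; exact: hyperstable_CMin.
Qed.

Lemma leaf_within_continuous (V : set M) : V `<=` star HS ->
  {within V, continuous leaf}.
Proof.
move=> VHS; apply: continuous_in_subspaceT => x /set_mem Vx.
by apply: leaf_continuous; exact: VHS.
Qed.

(** The map [leaf] is open onto HS. *)
Lemma leaf_image_near (V : set M) L x : hset L x -> nbhs x V ->
  \forall G \near L, HS G -> (leaf @` V) G.
Proof.
move=> Lx xV; apply: filterS (near_hyperspace_meets Lx xV) => G [y [Gy Vy]] GHS.
by exists y => //; exact: leaf_eq.
Qed.

Lemma star_open C : C `<=` HS ->
  (forall L, C L -> \forall G \near L, HS G -> C G) -> open (star C).
Proof.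
move=> CHS Co; rewrite openE => x [L CL Lx]; have LHS := CHS _ CL.
have sx : star HS x by exists L.
have : nbhs (leaf x) [set G | HS G -> C G].
  by rewrite (leaf_eq LHS Lx); exact: Co.
move=> /(leaf_continuous sx).
apply: filterS2 (near_leaf LHS Lx) => y [yHS yl] yC.
by exists (leaf y) => //; exact: yC.
Qed.

(** Compact neighbourhoods in C are the images under [leaf] of compact
    neighbourhoods in the open set C^*. *)
Lemma hyperstable_compact_nbhs C L : C `<=` HS -> open (star C) -> C L ->
  exists K, [/\ compact K, K `<=` C & \forall G \near L, C G -> K G].
Proof.
move=> CHS oC CL; have [x Lx] := hset_nonempty L.
have xC : nbhs x (star C) by apply: open_nbhs_nbhs; split=> //; exists L.
have x1 : neighbourhood [set x] (star C) by move=> _ ->.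
have [e e0 eC] := thickening_sub (@compact_set1 _ x) x1.
have e20 : 0 < e / 2 by rewrite divr_gt0.
have [B cB xB] := compact_sub_compact_interior lcM (@compact_set1 _ x).
pose N := B `&` closure (thickening (e / 2) [set x]).
have NC : N `<=` star C.
  by move=> y [_] /(closure_thickening e0)/eC.
have NHS : N `<=` star HS by move=> y /NC[G /CHS GHS Gy]; exists G.
have cN : compact N by apply: compact_closedI => //; exact: closed_closure.
have xN : nbhs x N.
  apply: filterI; first exact: xB.
  apply: filterS (neighbourhood_thickening (K := [set x]) e20 (erefl x)).
  exact: subset_closure.
exists (leaf @` N); split.
- by apply: continuous_compact => //; exact: leaf_within_continuous.
- by move=> _ [y /NC[G CG Gy] <-]; rewrite (leaf_eq (CHS _ CG) Gy).
- by apply: filterS (leaf_image_near Lx xN) => G + /CHS; apply.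
Qed.

Context (lconnM : locally_connected M).

(** The image under [leaf] of a connected open subset of HS^* is connected and
    open in HS. *)
Lemma hyperstable_locally_connected L U : HS L -> nbhs L U ->
  exists V, [/\ V L, connected V, V `<=` HS `&` U &
    forall G, V G -> \forall G' \near G, HS G' -> V G'].
Proof.
move=> LHS LU; have [x Lx] := hset_nonempty L.
have sx : star HS x by exists L.
have xU : \forall y \near x, HS (leaf y) /\ U (leaf y).
  have : nbhs (leaf x) U by rewrite (leaf_eq LHS Lx).
  move=> /(leaf_continuous sx).
  by apply: filterS2 (near_leaf LHS Lx) => y [yHS _] yU.
have xS : nbhs x (star HS).
  by apply: filterS (near_leaf LHS Lx) => y [? ?]; exists (leaf y).
have [V [oV Vx cV VU]] := lconnM (filterI xU xS).
have VS : V `<=` star HS by move=> y /VU[].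
exists (leaf @` V); split.
- by exists x => //; exact: leaf_eq.
- by apply: connected_continuous_connected => //; exact: leaf_within_continuous.
- by move=> _ [y /VU[[yHS yU] _] <-].
- move=> _ [y Vy <-]; have [G GHS Gy] := VS _ Vy.
  rewrite (leaf_eq GHS Gy); apply: leaf_image_near Gy _.
  by apply: open_nbhs_nbhs.
Qed.

Lemma component_near L G : connected_component HS L G ->
  \forall G' \near G, HS G' -> connected_component HS L G'.
Proof.
move=> LG; have GHS := connected_component_sub LG.
have [V [VG cV VHS oV]] := hyperstable_locally_connected GHS filterT.
apply: filterS (oV _ VG) => G' + G'HS => /(_ G'HS) VG'.
rewrite (same_connected_component LG).
by apply: (connected_component_max VG) VG' => // H /VHS[].
Qed.

Lemma component_star_open L : open (star (connected_component HS L)).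
Proof.
apply: star_open; first exact: connected_component_sub.
by move=> G; exact: component_near.
Qed.

Lemma component_peano L :
  generalized_peano_continuum (set_type (connected_component HS L)).
Proof.
set X := connected_component HS L.
have XHS : X `<=` HS by exact: connected_component_sub.
split.
- move=> G _.
  have [K [cK KX GK]] :=
    hyperstable_compact_nbhs XHS (component_star_open L) (set_valP G).
  have cK' := compact_set_type KX cK.
  exists (set_val @^-1` K).
    by apply: filterS (set_val_nbhs GK) => H + _; apply; exact: set_valP.
  by split=> //; apply: compact_closed => //; exact: metric_hausdorff.
- rewrite (_ : [set: set_type X] = set_val @^-1` X).
    by apply: connected_set_type => //; exact: component_connected.
  by apply/seteqP; split=> // G _; exact: set_valP.
- move=> G U /nbhs_set_type[U' GU' U'U].
  have [V [VG cV VHS oV]] :=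
    hyperstable_locally_connected (XHS _ (set_valP G)) GU'.
  have VX : V `<=` X.
    rewrite /X (same_connected_component (set_valP G)).
    by apply: connected_component_max VG _ cV => H /VHS[].
  exists (set_val @^-1` V); split=> //.
  + rewrite openE => H VH; apply: filterS (set_val_nbhs (oV _ VH)) => H'.
    by apply; apply: XHS; exact: set_valP.
  + exact: connected_set_type.
  + by move=> H /VHS[_ /U'U].
Qed.

Lemma component_clopen L :
  clopen [set G : set_type HS | connected_component HS L (set_val G)].
Proof.
split.
  rewrite openE => G LG; apply: filterS (set_val_nbhs (component_near LG)) => H.
  by apply; exact: set_valP.
rewrite -openC openE => G nLG.
have GG := connected_component_refl (set_valP G).
apply: filterS (set_val_nbhs (component_near GG)) => H GH LH; apply: nLG.
apply: connected_component_trans LH _; apply: connected_component_sym.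
by apply: GH; exact: set_valP.
Qed.

Context (connM : connected [set: M]).

(** A component reduced to L makes L = L^* open and closed in M, hence equal
    to M; no other minimal set is then possible. *)
Lemma component_non_degenerate L : HS L ->
  @hset R M @` HS <> [set [set: M]] ->
  non_degenerate (set_type (connected_component HS L)).
Proof.
move=> LHS nM; apply: contrapT => deg; apply: nM.
have LL := connected_component_refl LHS.
have XL G : connected_component HS L G -> G = L.
  move=> LG; apply: contrapT => GL; apply: deg.
  by exists (SigSub (mem_set LG)), (SigSub (mem_set LL)) => -[].
have sL : star (connected_component HS L) = L.
  by apply/seteqP; split=> [x [G /XL ->]//|x Lx]; exists L.
have LT : hset L = setT.
  apply: connM.
  - exact: hset_nonempty.
  - by exists L; rewrite ?setTI// -sL; exact: component_star_open.
  - exists L; rewrite ?setTI//; apply: compact_closed; last exact: hset_compact.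
    exact: metric_hausdorff.
apply/seteqP; split=> [_ [G GHS <-]|_ ->]; last by exists L.
have [x Gx] := hset_nonempty G.
rewrite -LT /=; congr hset.
by apply: (CMin_meet_eq (x := x)); rewrite ?LT//; exact: hyperstable_CMin.
Qed.

(** Each component X has a nonempty open X^*, which meets the dense range of f.
    The set beta keeps the first index n for which the leaf through [f n] is in
    a given component. *)
Lemma countably_many_components (f : nat -> M) : closure (range f) = setT ->
  exists (beta : set nat) (a : nat -> hyperspace M),
    [/\ forall i, beta i -> HS (a i),
        HS = \bigcup_(i in beta) connected_component HS (a i) &
        trivIset beta (fun i => connected_component HS (a i))].
Proof.
move=> fT; pose X n := connected_component HS (leaf (f n)).
pose beta := [set n | HS (leaf (f n)) /\
  forall m, (m < n)%N -> ~ X m (leaf (f n))].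
have meet G : HS G -> exists n, X n G.
  move=> GHS; have GG := connected_component_refl GHS.
  have [x Gx] := hset_nonempty G.
  have xs : nbhs x (star (connected_component HS G)).
    by apply: open_nbhs_nbhs; split; [exact: component_star_open|exists G].
  have : closure (range f) x by rewrite fT.
  move=> /(_ _ xs)[_ [[n _ <-] [H GH Hn]]]; exists n.
  have HHS := connected_component_sub GH.
  by rewrite /X (leaf_eq HHS Hn); exact: connected_component_sym.
have XHS n G : X n G -> HS (leaf (f n)).
  by move/connected_component_sym/connected_component_sub.
exists beta, (leaf \o f); split; first by move=> i [].
- apply/seteqP; split=> [G GHS|G [n _]]; last exact: connected_component_sub.
  have ex : exists n, `[< X n G >].
    by have [n Xn] := meet G GHS; exists n; exact/asboolP.
  have [n /asboolP Xn nmin] := ex_minnP ex.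
  exists n => //; split; first exact: XHS Xn.
  move=> m mn Xm; suff : (n <= m)%N by rewrite leqNgt mn.
  by apply/nmin/asboolP; exact: connected_component_trans Xm Xn.
- apply/trivIsetP => i j bi bj ij; rewrite -subset0 => G [Xi Xj].
  wlog lt_ij : i j bi bj ij Xi Xj / (i < j)%N.
    move=> H; move: (ij); rewrite neq_ltn => /orP[|]; first exact: H.
    by apply: H => //; rewrite eq_sym.
  have [_ /(_ _ lt_ij)] := bj; apply.
  by apply: connected_component_trans Xi _; exact: connected_component_sym.
Qed.

End hyperstability.

Theorem theorem3 (R : realType) (M : metricType R) (phi : R -> M -> M)
    (hM : generalized_peano_continuum M) (hphi : is_flow phi)
    (hnw : nonwandering phi) :
  let HS := hyperstable_min phi in
  (HS = set0 <-> CMin phi `<=` closure (unstable_min phi)) /\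
  (@hset R M @` HS = [set [set: M]] <->
    compact [set: M] /\ minimal_flow phi) /\
  [\/ HS = set0,
      @hset R M @` HS = [set [set: M]] |
      exists (beta : set nat) (X : nat -> set (hyperspace M)),
        [/\ beta !=set0, HS = \bigcup_(i in beta) X i, trivIset beta X &
            forall i, beta i ->
              [/\ generalized_peano_continuum (set_type (X i)),
                  non_degenerate (set_type (X i)),
                  clopen [set L : set_type HS | X i (set_val L)] &
                  [/\ star (X i) !=set0, connected (star (X i)),
                      open (star (X i)) & flow_invariant phi (star (X i))]]]].
Proof.
move=> HS; have [lcM connM lconnM] := hM; split; [|split].
- split=> [HS0 L Lm|cl].
    apply: contrapT => /(hyperstable_closure_unstable hphi Lm).
    by rewrite -/HS HS0.
  rewrite -subset0 => L LHS; have Lm := hyperstable_CMin LHS.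
  by have /(hyperstable_closure_unstable hphi Lm) := LHS; apply; exact: cl.
- split=> [HSM|[cM Mm]].
    have [L LHS LT] : (@hset R M @` HS) setT by rewrite HSM.
    split; first by rewrite -LT; exact: hset_compact.
    by rewrite /minimal_flow -LT; exact: hyperstable_CMin.
  have [M0 _ _ Mmin] := Mm; pose L := Hyperspace cM M0.
  have CM G : CMin phi G -> hset G = setT.
    by move=> [G0 Gc Gi _]; exact: Mmin.
  apply/seteqP; split=> [_ [G [/CM GT _] <-]//|_ ->].
  (* When M is the only minimal set, every neighbourhood of it is M itself, so
     nothing is unstable. *)
  exists L => //; split=> //; exists setT; first by move=> x _; exact: filterT.
  move=> G [Gm nGs]; case: nGs => V; rewrite (CM _ Gm) => VT.
  have {}VT : V = setT.
    by rewrite -subTset => x _; exact: nbhs_singleton (VT x Logic.I).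
  by exists setT; split; rewrite ?VT// => x _; exact: filterT.
- have [HS0|/eqP/set0P[L0 L0HS]] := pselect (HS = set0); first exact: Or31.
  have [HSM|HSM] := pselect (@hset R M @` HS = [set [set: M]]).
    exact: Or32.
  apply: Or33; have [x0 _] := hset_nonempty L0.
  have [f fT] := connected_locally_compact_separable x0 lcM connM.
  have [beta [a [aHS HSU trivX]]] :=
    countably_many_components hphi hnw lcM lconnM fT.
  exists beta, (fun i => connected_component HS (a i)); split=> //.
    by move: L0HS; rewrite {1}/HS HSU => -[i]; exists i.
  move=> i /aHS aiHS.
  have XHS := @connected_component_sub _ HS (a i).
  have XM : connected_component HS (a i) `<=` CMin phi.
    by move=> G /XHS; exact: hyperstable_CMin.
  split.
  + exact: component_peano.
  + exact: component_non_degenerate.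
  + exact: component_clopen.
  split.
  + have [x ax] := hset_nonempty (a i); exists x, (a i) => //.
    exact: connected_component_refl.
  + by apply: (star_connected hphi) => //; exact: component_connected.
  + exact: component_star_open.
  + exact: star_invariant.
Qed.
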